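(* Let $f:\mathbb{R}^n\to\mathbb{R}\cup\{\infty\}$ be proper, lower semicontinuous and lower bounded, and let $F:\mathbb{R}^n\to\mathbb{R}^p$ be locally Lipschitz and such that $\{z\in\operatorname{dom} f : F(z)=0\}\neq\emptyset$. Consider the problem $$\operatorname*{minimize}_{z\in\mathbb{R}^n} f(z)\quad\text{subject to } F(z)=0 .$$ Then the augmented Lagrangian algorithm described in the context, applied to this problem with any admissible input data (feasible point $z^0$, multiplier $\lambda^0$, penalty $\beta_0>0$, parameters $0<\gamma<1<\alpha,\xi$, tolerance $\varepsilon>0$), terminates in finite time (that is, after finitely many iterations $k$) and returns an $\varepsilon$-KKT pair for the problem.
   Context: Here $\operatorname{dom} f=\{z: f(z)<\infty\}$, $\|\cdot\|$ is the Euclidean norm and $\|\cdot\|_\infty$ the max norm. For $\beta\ge 0$ and $\lambda\in\mathbb{R}^p$, the $\beta$-augmented Lagrangian is $$\mathcal{L}_\beta(z,\lambda)=f(z)+\langle\lambda,F(z)\rangle+\tfrac{\beta}{2}\|F(z)\|^2,$$ and $\mathcal{L}:=\mathcal{L}_0$ is the (non-augmented) Lagrangian. For a function $h:\mathbb{R}^n\to\mathbb{R}\cup\{\infty\}$, $\partial h$ denotes the limiting (Mordukhovich) subdifferential in the sense of Rockafellar and Wets, and $\partial_z$ denotes this subdifferential with respect to $z$. The notation $\|\nabla_z \mathcal{L}_\beta(z,\lambda)\|_\infty\le\varepsilon$ means that there is a vector $v\in\partial_z\mathcal{L}_\beta(z,\lambda)$ with $\|v\|_\infty\le\varepsilon$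 (when $\mathcal{L}_\beta(\cdot,\lambda)$ is differentiable, $v$ is the gradient). A pair $(z,\lambda)$ is an $\varepsilon$-KKT pair if $\|\nabla_z\mathcal{L}(z,\lambda)\|_\infty\le\varepsilon$ and $\|F(z)\|_\infty\le\varepsilon$. Algorithm. Input: an initial feasible point $z^0\in\operatorname{dom} f$ with $F(z^0)=0$, a multiplier $\lambda^0\in\mathbb{R}^p$, a penalty $\beta_0>0$, parameters $\gamma\in(0,1)$, $\alpha>1$, $\xi>1$, and a tolerance $\varepsilon>0$. For $k=0,1,2,\dots$: 1. Set $\hat z^k=z^k$ if $\mathcal{L}_{\beta_k}(z^k,\lambda^k)\le f(z^0)$ (note that $f(z^0)=\mathcal{L}_{\beta_k}(z^0,\lambda^k)$), and $\hat z^k=z^0$ otherwise. 2. Starting at $\hat z^k$, apply a descent method to the minimization of $\mathcal{L}_{\beta_k}(\cdot,\lambda^k)$ to compute an $\varepsilon$-stationary point $z^{k+1}$, i.e. a point with $\|\nabla_z\mathcal{L}_{\beta_k}(z^{k+1},\lambda^k)\|_\infty\le\varepsilon$. (A descent method does not increase the objective, so that $\mathcal{L}_{\beta_k}(z^{k+1},\lambda^k)\le\mathcal{L}_{\beta_k}(\hat z^k,\lambda^k)$. This inner step is treated as a subroutine that successfully returns such a point.) 3. Set $\lambda^{k+1}=\lambda^k+\beta_kF(z^{k+1})$. 4. If $\|F(z^{k+1})\|_\infty\le\varepsilon$, stop and return $(z^{k+1},\lambda^{k+1})$. 5. Set $\beta_{k+1}=\beta_k$ if $\|F(z^{k+1})\|_\infty\le\gamma\|F(z^k)\|_\infty$,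 and $\beta_{k+1}=\max\{\xi\beta_k,\ \beta_0(k+1)^\alpha\}$ otherwise. *)

(* Defs.v *)
(* Vectors of R^n are row vectors 'rV[R]_n over an arbitrary
   R : realType. The library norm `|v| on 'rV[R]_n is the max norm. *)
From HB Require Import structures.
From mathcomp Require Export all_boot all_order all_algebra.
From mathcomp Require Export all_classical all_reals all_analysis.
Export Order.TTheory GRing.Theory Num.Theory.
Export numFieldNormedType.Exports.

Set Implicit Arguments.
Unset Strict Implicit.
Unset Printing Implicit Defensive.

Local Open Scope classical_set_scope.
Local Open Scope ring_scope.

Definition dotv (R : realType) (n : nat) (u v : 'rV[R]_n) : R :=
  \sum_(i < n) u 0 i * v 0 i.

Definition enorm (R : realType) (n : nat) (u : 'rV[R]_n) : R :=
  Num.sqrt (dotv u u).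

Definition edom (R : realType) (n : nat) (f : 'rV[R]_n -> \bar R)
  : set 'rV[R]_n := [set z | (f z < +oo)%E].

(* The codomain of f is \bar R; excluding -oo makes f a function into
   R \cup {+oo}. *)
Definition proper_fun (R : realType) (n : nat) (f : 'rV[R]_n -> \bar R) : Prop :=
  (forall z, f z != -oo%E) /\ edom f !=set0.

Definition lower_bounded (R : realType) (n : nat) (f : 'rV[R]_n -> \bar R)
  : Prop := exists m : R, forall z, (m%:E <= f z)%E.

Definition locally_lipschitz (R : realType) (n p : nat)
    (F : 'rV[R]_n -> 'rV[R]_p) : Prop :=
  forall z : 'rV[R]_n, exists2 U, nbhs z U & [lipschitz F x | x in U].

(* v is a regular (Frechet) subgradient of h at x: h x is finite and
   h y >= h x + <v, y - x> + o(||y - x||) as y --> x, where the one-sided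
   little-o is unfolded, i.e.
   liminf_(y --> x, y != x) (h y - h x - <v, y - x>) / ||y - x|| >= 0. *)
Definition regular_subdiff (R : realType) (n : nat) (h : 'rV[R]_n -> \bar R)
    (x : 'rV[R]_n) : set 'rV[R]_n :=
  [set v | h x \is a fin_num /\
    forall e : R, 0 < e -> \forall y \near x,
      (h x + (dotv v (y - x) - e * enorm (y - x))%:E <= h y)%E].

(* Limiting (Mordukhovich) subdifferential: limits of regular subgradients
   along h-attentive convergence (xs --> x together with h xs --> h x);
   empty where h is not finite. *)
Definition limiting_subdiff (R : realType) (n : nat) (h : 'rV[R]_n -> \bar R)
    (x : 'rV[R]_n) : set 'rV[R]_n :=
  [set v | h x \is a fin_num /\
    exists xs vs : nat -> 'rV[R]_n,
      [/\ xs @ \oo --> x,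
          (fun i => h (xs i)) @ \oo --> h x,
          forall i, regular_subdiff h (xs i) (vs i)
        & vs @ \oo --> v]].

Definition eps_stationary (R : realType) (n : nat) (h : 'rV[R]_n -> \bar R)
    (eps : R) (z : 'rV[R]_n) : Prop :=
  exists2 v, limiting_subdiff h z v & `|v| <= eps.

Definition aug_lagrangian (R : realType) (n p : nat) (f : 'rV[R]_n -> \bar R)
    (F : 'rV[R]_n -> 'rV[R]_p) (beta : R) (z : 'rV[R]_n) (lam : 'rV[R]_p)
  : \bar R :=
  (f z + (dotv lam (F z) + beta / 2 * enorm (F z) ^+ 2)%:E)%E.

Definition lagrangian (R : realType) (n p : nat) (f : 'rV[R]_n -> \bar R)
    (F : 'rV[R]_n -> 'rV[R]_p) (z : 'rV[R]_n) (lam : 'rV[R]_p) : \bar R :=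
  aug_lagrangian f F 0 z lam.

Definition eps_KKT (R : realType) (n p : nat) (f : 'rV[R]_n -> \bar R)
    (F : 'rV[R]_n -> 'rV[R]_p) (eps : R) (z : 'rV[R]_n) (lam : 'rV[R]_p)
  : Prop :=
  eps_stationary (fun y => lagrangian f F y lam) eps z /\ `|F z| <= eps.

(* Iteration k is executed iff the stopping test failed in all earlier
   iterations j < k (iteration j tests the point z j.+1). *)
Definition al_executed (R : realType) (n p : nat) (F : 'rV[R]_n -> 'rV[R]_p)
    (eps : R) (z : nat -> 'rV[R]_n) (k : nat) : Prop :=
  forall j, (j < k)%N -> eps < `|F (z j.+1)|.

Definition al_stops_at (R : realType) (n p : nat) (F : 'rV[R]_n -> 'rV[R]_p)
    (eps : R) (z : nat -> 'rV[R]_n) (k : nat) : Prop :=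
  al_executed F eps z k /\ `|F (z k.+1)| <= eps.

Definition al_start (R : realType) (n p : nat) (f : 'rV[R]_n -> \bar R)
    (F : 'rV[R]_n -> 'rV[R]_p) (z0 : 'rV[R]_n) (beta : R) (z : 'rV[R]_n)
    (lam : 'rV[R]_p) : 'rV[R]_n :=
  if (aug_lagrangian f F beta z lam <= f z0)%E then z else z0.

(* (z, lam, beta) are the iterates of a run of the augmented Lagrangian
   algorithm. The inner solver is nondeterministic: any eps-stationary point
   not increasing the objective may be chosen. Only executed iterations are
   constrained, so that a run stopping at iteration k is represented by
   sequences with arbitrary values after z k.+1, lam k.+1 and beta k. *)
Record al_run (R : realType) (n p : nat) (f : 'rV[R]_n -> \bar R)
    (F : 'rV[R]_n -> 'rV[R]_p) (z0 : 'rV[R]_n) (lam0 : 'rV[R]_p)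
    (beta0 gamma alpha xi eps : R)
    (z : nat -> 'rV[R]_n) (lam : nat -> 'rV[R]_p) (beta : nat -> R) : Prop := {
  al_z0 : z 0%N = z0;
  al_lam0 : lam 0%N = lam0;
  al_beta0 : beta 0%N = beta0;
  al_descent : forall k, al_executed F eps z k ->
    (aug_lagrangian f F (beta k) (z k.+1) (lam k) <=
     aug_lagrangian f F (beta k)
       (al_start f F z0 (beta k) (z k) (lam k)) (lam k))%E;
  al_stationary : forall k, al_executed F eps z k ->
    eps_stationary (fun y => aug_lagrangian f F (beta k) y (lam k)) eps (z k.+1);
  al_multiplier : forall k, al_executed F eps z k ->
    lam k.+1 = lam k + beta k *: F (z k.+1);
  al_penalty : forall k, al_executed F eps z k.+1 ->
    beta k.+1 = if `|F (z k.+1)| <= gamma * `|F (z k)| then beta k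
                else Num.max (xi * beta k) (beta0 * (k.+1%:R `^ alpha))
}.

(* Main.v *)
(* Termination. Completing the square in L_beta(z_{k+1}, lam_k) <= f(z_0) gives
   |lam_{k+1}|^2 <= |lam_k|^2 + 2 beta_k (f(z_0) - inf f); since beta is
   nondecreasing, beta_k^2 |F(z_{k+1})|^2 = |lam_{k+1} - lam_k|^2 is at most
   O(1) + O(k beta_k). An infeasible run therefore has beta_k = O(k), which is
   incompatible with infinitely many updates beta_{k+1} >= beta_0 (k+1)^alpha,
   alpha > 1; without updates F(z_k) decays geometrically.

   Stationarity. With x = z_{k+1}, L_beta(., lam_k) and L(., lam_{k+1}) differ by
   beta/2 |F - F(x)|^2 plus a constant, which is strictly differentiable at x
   with zero derivative, and such a perturbation does not change the limiting
   subdifferential at x (a fuzzy sum rule). *)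
Require Import Defs.
From mathcomp Require Import ring lra.

Set Implicit Arguments.
Unset Strict Implicit.
Unset Printing Implicit Defensive.

Local Open Scope classical_set_scope.
Local Open Scope ring_scope.

(** * Inner product, and comparison of the Euclidean norm with the max norm *)

Section Dotv.
Variables (R : realType) (n : nat).
Implicit Types u v w : 'rV[R]_n.

Lemma dotvC u v : dotv u v = dotv v u.
Proof. by apply: eq_bigr => i _; rewrite mulrC. Qed.

Lemma dotvDl u v w : dotv (u + v) w = dotv u w + dotv v w.
Proof. by rewrite -big_split; apply: eq_bigr => i _; rewrite mxE mulrDl. Qed.

Lemma dotvDr u v w : dotv u (v + w) = dotv u v + dotv u w.
Proof. by rewrite dotvC dotvDl !(dotvC _ u). Qed.

Lemma dotvZl (a : R) u v : dotv (a *: u) v = a * dotv u v.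
Proof. by rewrite big_distrr; apply: eq_bigr => i _; rewrite /= mxE mulrA. Qed.

Lemma dotvZr (a : R) u v : dotv u (a *: v) = a * dotv u v.
Proof. by rewrite dotvC dotvZl dotvC. Qed.

Lemma dotvNl u v : dotv (- u) v = - dotv u v.
Proof. by rewrite -scaleN1r dotvZl mulN1r. Qed.

Lemma dotvNr u v : dotv u (- v) = - dotv u v.
Proof. by rewrite dotvC dotvNl dotvC. Qed.

Lemma dotv0r u : dotv u 0 = 0.
Proof. by rewrite -(scale0r u) dotvZr mul0r. Qed.

Definition dotvE := (dotvDl, dotvDr, dotvNl, dotvNr, dotvZl, dotvZr).

Lemma dotv_ge0 u : 0 <= dotv u u.
Proof. by apply: sumr_ge0 => i _; exact: sqr_ge0. Qed.

Lemma normr_coord_le u i : `|u 0 i| <= `|u|.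
Proof.
rewrite [leRHS]/Num.norm /= mx_normrE.
exact: (le_bigmax_cond _ (fun ij => `|u ij.1 ij.2|) (j := (0, i))).
Qed.

Lemma normr_dotv_le u v : `|dotv u v| <= n%:R * (`|u| * `|v|).
Proof.
apply: (le_trans (ler_norm_sum _ _ _)).
apply: (@le_trans _ _ (\sum_(i < n) `|u| * `|v|)).
  by apply: ler_sum => i _; rewrite normrM ler_pM// normr_coord_le.
by rewrite sumr_const card_ord mulr_natl.
Qed.

Lemma normr_sqr_le_dotv u : `|u| ^+ 2 <= dotv u u.
Proof.
rewrite [`|u|]/Num.norm /= mx_normrE.
have [|/mx_norm_neq0[[i j] /= H]] := eqVneq (mx_norm u) 0.
  by rewrite mx_normrE => ->; rewrite expr0n dotv_ge0.
move: H; rewrite mx_normrE => ->; rewrite (ord1 i) real_normK ?num_real//.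
by rewrite /dotv (bigD1 j)//= -expr2 lerDl sumr_ge0// => k _; exact: sqr_ge0.
Qed.

Lemma enorm_sqr u : enorm u ^+ 2 = dotv u u.
Proof. by rewrite sqr_sqrtr// dotv_ge0. Qed.

Lemma enorm_ge0 u : 0 <= enorm u.
Proof. exact: sqrtr_ge0. Qed.

Lemma normr_le_enorm u : `|u| <= enorm u.
Proof.
by rewrite -(@ler_pXn2r _ 2) ?nnegrE ?enorm_ge0// enorm_sqr normr_sqr_le_dotv.
Qed.

(** A crude constant suffices for the local estimates below; [n.+1] rather than [n] keeps it
    positive, hence a legitimate divisor, when [n = 0]. *)
Lemma enorm_le_normr u : enorm u <= n.+1%:R * `|u|.
Proof.
rewrite -(@ler_pXn2r _ 2) ?nnegrE ?enorm_ge0 ?mulr_ge0// enorm_sqr.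
apply: le_trans (le_trans (ler_norm _) (normr_dotv_le u u)) _.
rewrite exprMn -!expr2 ler_wpM2r ?sqr_ge0// expr2 -natrM ler_nat.
exact: leq_trans (leqnSn n) (leq_pmulr _ _).
Qed.

Lemma cvg_dotv (T : Type) (G : set_system T) {FG : Filter G} (g h : T -> 'rV[R]_n) u v :
  g @ G --> u -> h @ G --> v -> (fun t => dotv (g t) (h t)) @ G --> dotv u v.
Proof.
move=> gu hv; apply: cvg_big => [|i _]; [exact: add_continuous|apply: cvgM].
- exact: (cvg_comp _ _ gu (@coord_continuous _ _ _ _ _ u)).
- exact: (cvg_comp _ _ hv (@coord_continuous _ _ _ _ _ v)).
Qed.

End Dotv.

(** * Lower semicontinuous functions: continuous perturbations and minimisers on compact sets *)

Section LowerSemicontinuous.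
Variables (R : realType) (X : topologicalType).

Lemma lower_semicontinuousD (h : X -> \bar R) (q : X -> R) :
  lower_semicontinuous h -> continuous q ->
  lower_semicontinuous (fun x => (h x + (q x)%:E)%E).
Proof.
move=> hl qc x a ax.
(* With [b] strictly between [a - q x] and [h x], near [x] both [h > b] and [q > a - b] hold, and
   they add up to the claim. *)
have [b [bh ba]] : exists b : R, (b%:E < h x)%E /\ a - q x < b.
  move: ax; case: (h x) => [r| |] //=.
    rewrite -EFinD lte_fin => ar; exists ((a - q x + r) / 2).
    by rewrite lte_fin; split; lra.
  by exists (a - q x + 1); split; [rewrite ltry|lra].
have [V Vx VP] := hl x b bh.
exists (V `&` [set y | a - b < q y]).
  apply: filterI => //.
  have qx : a - b < q x by lra.
  exact: (cvgr_gt _ (qc x) _ qx).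
move=> y [/VP]; case: (h y) => [r| |] //=.
  by rewrite -EFinD !lte_fin => br; rewrite /mkset => qy; lra.
by rewrite addye// => _ _; exact: ltry.
Qed.

(** If the infimum [I] were not attained, every point of [K] would have a neighbourhood on which [h]
    exceeds some real above [I]; compactness makes that real uniform, contradicting that [I] is the
    infimum. *)
Lemma compact_lsc_min (h : X -> \bar R) (K : set X) :
  compact K -> K !=set0 -> lower_semicontinuous h ->
  (exists m : R, forall x, K x -> (m%:E <= h x)%E) ->
  exists2 x, K x & forall y, K y -> (h x <= h y)%E.
Proof.
move=> Kc [x0 Kx0] hl [m mh].
apply: contrapT => nmin.
have {}nmin x : K x -> exists2 y, K y & (h y < h x)%E.
  move=> Kx; apply: contrapT => H; apply: nmin; exists x => // y Ky.
  by rewrite leNgt; apply/negP => yx; apply: H; exists y.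
pose I := ereal_inf (h @` K).
have Ilt x : K x -> (I < h x)%E.
  move=> /nmin[y Ky yx]; apply: le_lt_trans yx.
  by apply: ereal_inf_lbound; exists y.
have mI : (m%:E <= I)%E by apply/ereal_infP => _ [x Kx <-]; exact: mh.
case E : I mI => [i| |] // mI; last by have := Ilt _ Kx0; rewrite E ltNge leey.
(* The near-covering form of compactness is applied with levels [a] tending to [i] from the
   right. *)
move/compact_near_coveringP : Kc.
move=> /(_ R i^'+ (fun a x => (a%:E < h x)%E) _).
case.
  move=> x Kx; have := Ilt x Kx; rewrite E => ix.
  have [b ib bh] : exists2 b : R, i < b & (b%:E < h x)%E.
    move: ix; case: (h x) => [r| |] //=.
      by rewrite lte_fin => ir; exists ((i + r) / 2); rewrite ?lte_fin; lra.
    by exists (i + 1); [lra|rewrite ltry].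
  have [V Vx VP] := hl x b bh.
  exists (V, [set a | a < b]); first by split => //=; exact: nbhs_right_lt.
  by move=> [y a] [/= /VP by_ ab]; apply: lt_trans by_; rewrite lte_fin.
move=> e /= e0 H.
have := H (i + e / 2); rewrite /ball /= => H'.
have /H' KI : `|i - (i + e / 2)| < e by rewrite ltr_norml; lra.
have {}KI := KI ltac:(lra).
have : ((i + e / 2)%:E <= I)%E.
  by apply/ereal_infP => _ [x Kx <-]; apply: ltW; exact: KI.
by rewrite E lee_fin; lra.
Qed.

End LowerSemicontinuous.

(** * Regular and limiting subgradients: a fuzzy sum rule *)

Section Subdifferential.
Variables (R : realType) (n : nat).
Implicit Types (h : 'rV[R]_n -> \bar R) (x y v w : 'rV[R]_n).

(** Fermat's rule at a local minimiser: expanding the quadratic around [y] leaves only the remainder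
    [K * |t - y|^2], which is below [e * |t - y|] near [y]. *)
Lemma regular_subdiff_prox_min h x y v (K : R) : 0 < K -> h y \is a fin_num ->
  (\forall t \near y,
    (h y + (K * dotv (y - x) (y - x) - dotv v (y - x))%:E <=
     h t + (K * dotv (t - x) (t - x) - dotv v (t - x))%:E)%E) ->
  regular_subdiff h y (v - (2 * K) *: (y - x)).
Proof.
move=> K0 hy ymin; split=> // e e0.
have c0 : 0 < e / (K * n.+1%:R) by rewrite divr_gt0 ?mulr_gt0.
near=> t.
have Ed : K * enorm (t - y) <= e.
  have : `|t - y| <= e / (K * n.+1%:R).
    rewrite distrC; apply: ltW; near: t.
    exact: (@cvgr_dist_lt _ _ _ (nbhs y) _ id y cvg_id _ c0).
  rewrite ler_pdivlMr ?mulr_gt0// mulrC => H.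
  apply: le_trans H; rewrite -mulrA ler_pM2l//; exact: enorm_le_normr.
have : (h y + (K * dotv (y - x) (y - x) - dotv v (y - x))%:E <=
     h t + (K * dotv (t - x) (t - x) - dotv v (t - x))%:E)%E by near: t.
have -> : t - x = (t - y) + (y - x) by rewrite addrA subrK.
have := enorm_sqr (t - y); have := enorm_ge0 (t - y); move: Ed.
rewrite -(fineK hy); move: (t - y) (y - x) (fine (h y)) => d a hr.
rewrite !dotvE (dotvC a d); case: (h t) => [r| |] //=.
  rewrite -!EFinD !lee_fin => Ed E0 E2 H.
  have KEE : K * dotv d d <= e * enorm d by rewrite -E2 expr2 mulrA ler_wpM2r.
  lra.
by move=> *; rewrite leey.
Unshelve. all: by end_near. Qed.


(* Minimising [h - <v, .> + K |. - x|^2] over a small ball, with K large, gives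
   a point y with K |y - x| <= d, so that the gradient of the quadratic term
   perturbs v by at most 2 d. *)
Lemma approx_subgradient_regular h x v (d : R) : lower_semicontinuous h ->
  h x \is a fin_num -> 0 < d ->
  (\forall t \near x, (h x + (dotv v (t - x) - d * enorm (t - x))%:E <= h t)%E) ->
  forall e : R, 0 < e -> exists y w,
    [/\ regular_subdiff h y w, `|y - x| < e,
        `|fine (h y) - fine (h x)| < e & `|w - v| <= 2 * d].
Proof.
move=> hl hx d0 /nbhs_ballP[r0 /= r00 near_x] e e0.
pose r := r0 / 2; have r_gt0 : 0 < r by rewrite divr_gt0.
have rr0 : r < r0 by rewrite /r; lra.
pose m := Num.min r e; have m0 : 0 < m by rewrite lt_min r_gt0.
have [mr me] : m <= r /\ m <= e by rewrite !ge_min !lexx orbT.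
pose c := n%:R * `|v| + d + 1.
have c1 : 1 <= c by rewrite /c lerDr addr_ge0// ltW.
(* The minimiser will lie within [s] of [x]. Then [s < m] keeps it inside the ball and [e]-close to
   [x], [s * c = m / 2] bounds the change of [h] below [e], and [K * s = d] bounds half the
   perturbation of [v]. *)
pose s := m / 2 / c.
have s0 : 0 < s by rewrite !divr_gt0//; lra.
have scm : s * c = m / 2 by rewrite /s divfK//; lra.
have sm : s < m.
  have : s <= s * c by rewrite ler_peMr// ltW.
  lra.
pose K := d / s; have K0 : 0 < K by rewrite divr_gt0.
have Ks : K * s = d by rewrite /K divfK// gt_eqF.
pose B := closed_ball_ (fun u : 'rV[R]_n => `|u|) x r.
have near_B t : B t ->
    (h x + (dotv v (t - x) - d * enorm (t - x))%:E <= h t)%E.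
  move=> Bt; apply: near_x; rewrite -ball_normE /=; exact: le_lt_trans rr0.
have Bx : B x by rewrite /B /closed_ball_ /= subrr normr0 ltW.
have Bc : compact B.
  apply: bounded_closed_compact; last exact: closed_closed_ball_.
  exists (`|x| + r); split; first exact: num_real.
  move=> M xM t; rewrite /B /closed_ball_ /= => tr.
  have := ler_normB x (x - t); rewrite opprB addrC subrK; lra.
pose q t := K * dotv (t - x) (t - x) - dotv v (t - x).
have qc : continuous q.
  move=> t.
  have tx : (fun u : 'rV[R]_n => u - x) @ t --> t - x.
    exact: (cvgB (@cvg_id _ _) (cvg_cst x)).
  exact: cvgB (cvgM (cvg_cst K) (cvg_dotv tx tx)) (cvg_dotv (cvg_cst v) tx).
pose g t := (h t + (q t)%:E)%E.
have near_g t : B t ->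
    (h x + (K * enorm (t - x) ^+ 2 - d * enorm (t - x))%:E <= g t)%E.
  move=> /near_B; rewrite /g /q enorm_sqr -(fineK hx).
  case: (h t) => [a| |] //=; last by move=> *; rewrite leey.
  by rewrite -!EFinD !lee_fin; lra.
have [|y By ymin] := compact_lsc_min Bc (ex_intro _ x Bx)
  (lower_semicontinuousD hl qc).
  exists (fine (h x) - d * (n.+1%:R * r)) => t Bt.
  apply: le_trans (near_g t Bt).
  rewrite -[in leRHS](fineK hx) -EFinD lee_fin lerD2l.
  have : d * enorm (t - x) <= d * (n.+1%:R * r).
    rewrite ler_pM2l//; apply: le_trans (enorm_le_normr _) _.
    by rewrite ler_pM2l// distrC.
  have : 0 <= K * enorm (t - x) ^+ 2 by rewrite mulr_ge0 ?sqr_ge0 ?ltW.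
  lra.
have gx : g x = h x by rewrite /g /q subrr !dotv0r mulr0 subrr adde0.
have gyx : (g y <= h x)%E by rewrite -gx; exact: ymin.
have hy : h y \is a fin_num.
  have := le_trans (near_g y By) gyx; have := near_B y By; move: gyx.
  by rewrite /g -(fineK hx); case: (h y).
have E0 := enorm_ge0 (y - x); set E := enorm (y - x) in E0 *.
(* Since [g y <= g x = h x], the lower bound [near_g] forces [K * E^2 <= d * E], so
   [E <= d / K = s]. *)
have Es : E <= s.
  have := le_trans (near_g y By) gyx.
  rewrite -/E -[in X in (_ <= X)%E](fineK hx) -[in X in (X <= _)%E](fineK hx).
  rewrite -EFinD lee_fin => H.
  rewrite -(ler_pM2l K0) Ks leNgt; apply/negP => dKE.
  have Epos : 0 < E.
    by rewrite lt_neqAle E0 andbT; apply/eqP => E00; move: dKE; rewrite -E00; lra.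
  by have := ltr_pM2r Epos d (K * E); rewrite dKE -mulrA -expr2; lra.
have yxE : `|y - x| <= E by exact: normr_le_enorm.
have vE : `|dotv v (y - x)| <= n%:R * `|v| * E.
  apply: le_trans (normr_dotv_le _ _) _.
  by rewrite mulrA ler_wpM2l// mulr_ge0.
exists y, (v - (2 * K) *: (y - x)); split.
- apply: regular_subdiff_prox_min => //.
  (* As [y] is within [s < r] of [x], the ball of radius [r - s] around [y] stays in [B]: the
     constrained minimiser is a local one. *)
  have rs : 0 < r - s by lra.
  apply/nbhs_ballP; exists (r - s) => //= t; rewrite -ball_normE /= => yt.
  apply: ymin; rewrite /B /closed_ball_ /=.
  by have := ler_distD y x t; rewrite (distrC x y); lra.
- lra.
- have nE : n%:R * `|v| * E + d * E <= s * c.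
    have nc : n%:R * `|v| + d <= c by rewrite /c lerDl.
    rewrite -mulrDl mulrC ler_pM//.
    by rewrite addr_ge0 ?mulr_ge0// ltW.
  have := near_B y By; have := gyx.
  rewrite /g /q -enorm_sqr -/E -(fineK hy) -(fineK hx) -!EFinD !lee_fin !fineK//=.
  have KE : 0 <= K * E ^+ 2 by rewrite mulr_ge0 ?sqr_ge0 ?ltW.
  have dE : 0 <= d * E by rewrite mulr_ge0// ltW.
  move: vE; rewrite ler_norml ltr_norml => /andP[v1 v2] H1 H2.
  by apply/andP; split; lra.
- have K20 : 0 < 2 * K by lra.
  rewrite addrAC subrr add0r normrN normrZ (gtr0_norm K20) -mulrA.
  rewrite ler_pM2l// -Ks ler_pM2l//.
  exact: le_trans Es.
Qed.

(** Choosing approximants for [e = 1 / (i + 1)] gives the required sequences. [fine] loses nothing,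
    because a regular subgradient exists only where [h] is finite. *)
Lemma limiting_subdiff_approx h x v : h x \is a fin_num ->
  (forall e : R, 0 < e -> exists y w,
    [/\ regular_subdiff h y w, `|y - x| < e,
        `|fine (h y) - fine (h x)| < e & `|w - v| < e]) ->
  limiting_subdiff h x v.
Proof.
move=> hx approx; split=> //.
have cvg_of (V : normedModType R) (u : nat -> V) (l : V) :
    (forall i, `|u i - l| < i.+1%:R^-1) -> u @ \oo --> l.
  move=> ul; apply/cvgrPdist_lt => e e0; near=> i.
  rewrite distrC; apply: lt_trans (ul i) _; near: i.
  exact: (near_infty_natSinv_lt (PosNum e0)).
have /choice[yw ywP] (i : nat) : exists yw : 'rV[R]_n * 'rV[R]_n,
    [/\ regular_subdiff h yw.1 yw.2, `|yw.1 - x| < i.+1%:R^-1,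
        `|fine (h yw.1) - fine (h x)| < i.+1%:R^-1 & `|yw.2 - v| < i.+1%:R^-1].
  have [|y [w ?]] := approx i.+1%:R^-1; first by rewrite invr_gt0.
  by exists (y, w).
exists (fun i => (yw i).1), (fun i => (yw i).2); split.
- by apply: cvg_of => i; case: (ywP i).
- rewrite -(fineK hx); apply/fine_cvgP; split.
    by apply: nearW => i; case: (ywP i) => -[].
  by apply: (cvg_of R^o) => i; case: (ywP i).
- by move=> i; case: (ywP i).
- by apply: cvg_of => i; case: (ywP i).
Unshelve. all: by end_near. Qed.

(** The hypothesis on [q] is strict differentiability at [x] with zero derivative. Near [x], a
    regular subgradient of [h + q] is then one of [h] up to a small linear slack, which
    [approx_subgradient_regular] removes by moving the point slightly. *)
Lemma limiting_subdiff_strict_perturb h (q : 'rV[R]_n -> R) x v :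
  lower_semicontinuous h ->
  (forall e : R, 0 < e -> exists2 U, nbhs x U &
     forall y t, U y -> U t -> `|q y - q t| <= e * enorm (y - t)) ->
  limiting_subdiff (fun y => (h y + (q y)%:E)%E) x v ->
  limiting_subdiff h x v.
Proof.
move=> hl q_strict [Hx [xs [vs [xsx Hxs vs_reg vsv]]]].
have fin_h y : (h y + (q y)%:E)%E \is a fin_num -> h y \is a fin_num.
  by rewrite fin_numD => /andP[].
have hx := fin_h _ Hx.
apply: limiting_subdiff_approx => // e e0.
(* The slack [d] of the subgradient and the Lipschitz constant [d] of [q] add up to [2 * d], which
   costs [4 * d = e / 2] in the subgradient; the distance from [vs i] to [v] costs another
   [e / 4]. *)
pose d := e / 8; have d0 : 0 < d by rewrite divr_gt0.
have [U Ux qU] := q_strict d d0.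
(* The first bound controls the distance to [x], the second makes [q] vary by at most [e / 4]. *)
have s0 : 0 < Num.min (e / 2) (e / 4 / (d * n.+1%:R)).
  by rewrite lt_min !divr_gt0// mulr_gt0.
have e40 : 0 < e / 4 by rewrite divr_gt0.
have Hfine : (fun i => fine (h (xs i) + (q (xs i))%:E)) @ \oo -->
    fine (h x + (q x)%:E)%E.
  by apply: fine_cvg; rewrite fineK.
have : \forall i \near \oo, [/\ nbhs (xs i) U,
    `|x - xs i| < Num.min (e / 2) (e / 4 / (d * n.+1%:R)),
    `|v - vs i| < e / 4 &
    `|fine (h x + (q x)%:E)%E - fine (h (xs i) + (q (xs i))%:E)%E| < e / 4].
  near=> i; split; near: i.
  - exact: (xsx _ (nbhs_interior Ux)).
  - by move/cvgrPdist_lt : xsx => /(_ _ s0).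
  - by move/cvgrPdist_lt : vsv => /(_ _ e40).
  - by move/cvgrPdist_lt : Hfine => /(_ _ e40).
case=> N _ /(_ N (leqnn N)) []; move: (xs N) (vs N) (vs_reg N) => a w [Ha reg_a].
move=> nUa; rewrite lt_min => /andP[xa1 xa2] vw Hxa.
have ha := fin_h _ Ha.
have [||y [u [reg_u ya hya uw]]] :=
  @approx_subgradient_regular h a w (2 * d) hl ha _ _ (e / 4) e40.
- by rewrite mulr_gt0.
- near=> t.
  have Ut : U t by near: t.
  have /qU/(_ (nbhs_singleton nUa)) : U t by [].
  have : (h a + (q a)%:E + (dotv w (t - a) - d * enorm (t - a))%:E <=
          h t + (q t)%:E)%E by near: t; exact: reg_a.
  rewrite -(fineK ha); case: (h t) => [b| |] //=; last by move=> *; rewrite leey.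
  rewrite -!EFinD !lee_fin ler_norml => H /andP[_ ?]; lra.
exists y, u; split=> //.
- by have := ler_distD a y x; rewrite (distrC a x); lra.
- have : `|q x - q a| <= e / 4.
    apply: le_trans (qU _ _ (nbhs_singleton Ux) (nbhs_singleton nUa)) _.
    apply: (@le_trans _ _ (d * (n.+1%:R * `|x - a|))).
      by rewrite ler_pM2l// enorm_le_normr.
    by move/ltW : xa2; rewrite ler_pdivlMr ?mulr_gt0// mulrC mulrA.
  move: Hxa hya; rewrite !fineD//= !(ltr_norml, ler_norml).
  move=> /andP[? ?] /andP[? ?] /andP[? ?]; apply/andP; split; lra.
- by have := ler_distD w u v; rewrite (distrC w v); rewrite /d in uw *; lra.
Unshelve. all: by end_near. Qed.

End Subdifferential.

(** * Locally Lipschitz constraints and the passage from the augmented to the plain Lagrangian *)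

Section LocallyLipschitz.
Variables (R : realType) (n p : nat) (F : 'rV[R]_n -> 'rV[R]_p).
Hypothesis F_lip : locally_lipschitz F.

Lemma locally_lipschitz_bound (x : 'rV[R]_n) : exists U (M : R), [/\ nbhs x U, 0 < M &
  forall y t, U y -> U t -> `|F y - F t| <= M * `|y - t|].
Proof.
have [U Ux [M0 [_ M0P]]] := F_lip x.
pose M := `|M0| + 1; have M0M : M0 < M by rewrite /M; have := ler_norm M0; lra.
exists U, M; split => //; first by rewrite /M ltr_wpDl.
by move=> y t Uy Ut; have := M0P M M0M (y, t); exact.
Qed.

Lemma locally_lipschitz_continuous : continuous F.
Proof.
move=> x; have [U [M [Ux M0 FU]]] := locally_lipschitz_bound x.
apply/(@cvgrPdist_lt _ _ _ (nbhs x)) => e e0.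
have eM : 0 < e / M by rewrite divr_gt0.
have xball : nbhs x (ball x (e / M)) by exact: nbhsx_ballx.
apply: filterS2 (Ux) xball => t Ut; rewrite -ball_normE /= => xt.
apply: le_lt_trans (FU _ _ (nbhs_singleton Ux) Ut) _.
by rewrite mulrC -ltr_pdivlMr.
Qed.

(* Up to a constant this is [b / 2 * |F y - F x|^2]. *)
Lemma penalty_strict_differentiable (b : R) (x : 'rV[R]_n) (e : R) : 0 < e ->
  let q y := b / 2 * enorm (F y) ^+ 2 - b * dotv (F x) (F y) in
  exists2 U, nbhs x U &
    forall y t, U y -> U t -> `|q y - q t| <= e * enorm (y - t).
Proof.
move=> e0 q; have [U [M [Ux M0 FU]]] := locally_lipschitz_bound x.
pose c := `|b| * p%:R * M ^+ 2 + 1.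
have c0 : 0 < c by rewrite /c ltr_wpDl// mulr_ge0 ?sqr_ge0// mulr_ge0.
exists (U `&` ball x (e / c)).
  by apply: filterI => //; apply: nbhsx_ballx; rewrite divr_gt0.
move=> y t [Uy yc] [Ut tc].
(* The first factor is Lipschitz in [y - t], while the second is small near [x]; the radius [e / c]
   makes the product at most [e * |y - t|]. *)
have -> : q y - q t = b / 2 * dotv (F y - F t) ((F y - F x) + (F t - F x)).
  by rewrite /q !enorm_sqr !dotvE !(dotvC (F x)) (dotvC (F t) (F y)); field.
have Ux' := nbhs_singleton Ux.
have {yc} yc : `|y - x| <= e / c by move: yc; rewrite -ball_normE /= distrC => /ltW.
have {tc} tc : `|t - x| <= e / c by move: tc; rewrite -ball_normE /= distrC => /ltW.
rewrite normrM normf_div (@gtr0_norm _ 2)//.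
have H1 := FU _ _ Uy Ut.
have H2 : `|(F y - F x) + (F t - F x)| <= M * (2 * (e / c)).
  apply: le_trans (ler_normD _ _) _.
  have := FU _ _ Uy Ux'; have := FU _ _ Ut Ux'.
  have : M * `|y - x| <= M * (e / c) by rewrite ler_pM2l.
  have : M * `|t - x| <= M * (e / c) by rewrite ler_pM2l.
  lra.
have H3 := normr_dotv_le (F y - F t) ((F y - F x) + (F t - F x)).
have H4 : `|F y - F t| * `|(F y - F x) + (F t - F x)| <=
          (M * `|y - t|) * (M * (2 * (e / c))) by rewrite ler_pM.
apply: (@le_trans _ _ (`|b| / 2 * (p%:R * ((M * `|y - t|) * (M * (2 * (e / c))))))).
  rewrite ler_wpM2l//; apply: le_trans H3 _; by rewrite ler_wpM2l.
rewrite [leLHS](_ : _ = (`|b| * p%:R * M ^+ 2 / c) * e * `|y - t|); last first.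
  by field; rewrite gt_eqF.
apply: (@le_trans _ _ (e * `|y - t|)).
  rewrite -mulrA ler_piMl//; first by rewrite mulr_ge0// ltW.
  by rewrite ler_pdivrMr// mul1r /c lerDl.
by rewrite ler_pM2l// normr_le_enorm.
Qed.

Lemma lagrangian_lsc f (lam : 'rV[R]_p) : lower_semicontinuous f ->
  lower_semicontinuous (fun y => lagrangian f F y lam).
Proof.
move=> fl; apply: lower_semicontinuousD => // x.
have Fx := @locally_lipschitz_continuous x.
rewrite mul0r; under eq_fun do rewrite mul0r.
exact: cvgD (cvg_dotv (cvg_cst lam) Fx) (cvg_cst 0).
Qed.

Lemma eps_stationary_multiplier_update f (b eps : R) (x : 'rV[R]_n) (lam : 'rV[R]_p) :
  lower_semicontinuous f ->
  eps_stationary (fun y => aug_lagrangian f F b y lam) eps x ->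
  eps_stationary (fun y => lagrangian f F y (lam + b *: F x)) eps x.
Proof.
move=> fl [v vL veps]; exists v => //; move: vL.
pose q y := b / 2 * enorm (F y) ^+ 2 - b * dotv (F x) (F y).
(* The new multiplier absorbs the term [b * dotv (F x) (F y)], leaving [q] as the perturbation. *)
have -> : (fun y => aug_lagrangian f F b y lam) =
    (fun y => (lagrangian f F y (lam + b *: F x)%R + (q y)%:E)%E).
  apply/funext => y; rewrite /lagrangian /aug_lagrangian /q -addeA -EFinD.
  by congr (_ + _%:E)%E; rewrite !dotvE; lra.
apply: limiting_subdiff_strict_perturb; first exact: lagrangian_lsc.
by move=> e e0; exact: penalty_strict_differentiable.
Qed.

End LocallyLipschitz.

(** * Multiplier growth, penalty growth and finite termination *)

Section Termination.
Variables (R : realType) (n p : nat).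
Variables (f : 'rV[R]_n -> \bar R) (F : 'rV[R]_n -> 'rV[R]_p).

Lemma aug_lagrangian_feasible (beta : R) x (lam : 'rV[R]_p) : F x = 0 ->
  aug_lagrangian f F beta x lam = f x.
Proof.
by move=> Fx; rewrite /aug_lagrangian enorm_sqr Fx !dotv0r mulr0 addr0 adde0.
Qed.

Lemma al_start_le (z0 x : 'rV[R]_n) (beta : R) (lam : 'rV[R]_p) : F z0 = 0 ->
  (aug_lagrangian f F beta (al_start f F z0 beta x lam) lam <= f z0)%E.
Proof.
by move=> Fz0; rewrite /al_start; case: ifPn => // _; rewrite aug_lagrangian_feasible.
Qed.

(** The increase of the squared multiplier norm is exactly [2 * beta] times the constraint terms of
    the augmented Lagrangian, and those are at most [r - m]. *)
Lemma multiplier_update_le (m r beta : R) x (lam : 'rV[R]_p) :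
  0 <= beta -> (m%:E <= f x)%E -> (aug_lagrangian f F beta x lam <= r%:E)%E ->
  dotv (lam + beta *: F x) (lam + beta *: F x) <=
  dotv lam lam + 2 * beta * (r - m).
Proof.
move=> b0; rewrite /aug_lagrangian enorm_sqr; case: (f x) => [s| |] //=.
rewrite -EFinD !lee_fin => ms H.
have : beta * (dotv lam (F x) + beta / 2 * dotv (F x) (F x)) <= beta * (r - m).
  by rewrite ler_wpM2l//; lra.
rewrite !dotvE (dotvC (F x) lam); lra.
Qed.

Lemma al_run_reaches_feasibility (z0 : 'rV[R]_n) (lam0 : 'rV[R]_p)
    (beta0 gamma alpha xi eps : R) z lam beta :
  lower_bounded f -> edom f z0 -> F z0 = 0 -> 0 < beta0 ->
  0 < gamma -> gamma < 1 -> 1 < alpha -> 1 < xi -> 0 < eps ->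
  al_run f F z0 lam0 beta0 gamma alpha xi eps z lam beta ->
  exists k, `|F (z k.+1)| <= eps.
Proof.
move=> [m fm] z0_dom Fz0 b0 g0 g1 a1 xi1 e0 run.
apply: contrapT => infeasible.
have Feps k : eps < `|F (z k.+1)|.
  by rewrite ltNge; apply/negP => Fk; apply: infeasible; exists k.
(* In an infeasible run no test succeeds, so every clause of [al_run] holds at every index. *)
have exec k : al_executed F eps z k by move=> j _; exact: Feps.
have {z0_dom} fz0 : f z0 \is a fin_num.
  by move: z0_dom (fm z0); rewrite /edom /=; case: (f z0).
pose C := fine (f z0) - m.
have C0 : 0 <= C by rewrite subr_ge0 -lee_fin fineK.
have beta_ge k : beta0 <= beta k /\ beta k <= beta k.+1.
  have mono j : 0 < beta j -> beta j <= beta j.+1.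
    move=> bj; rewrite (al_penalty run (exec _)); case: ifPn => // _.
    by rewrite le_max ler_peMl// ltW.
  have ge0 : beta0 <= beta k.
    elim: k => [|k IH]; first by rewrite (al_beta0 run).
    exact: le_trans IH (mono _ (lt_le_trans b0 IH)).
  by split=> //; apply: mono; exact: lt_le_trans ge0.
have beta_gt0 k : 0 < beta k by apply: lt_le_trans b0 _; case: (beta_ge k).
pose L k := dotv (lam k) (lam k).
have L_step k : L k.+1 <= L k + 2 * beta k * C.
  rewrite /L (al_multiplier run (exec k)).
  apply: multiplier_update_le; [exact: ltW|exact: fm|rewrite fineK//].
  exact: le_trans (al_descent run (exec k)) (al_start_le _ _ _ Fz0).
(* Monotonicity of [beta] replaces the sum of the first [k] penalties by [k * beta k]. *)
have L_sum k : L k <= L 0 + 2 * C * (k%:R * beta k).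
  elim: k => [|k IH]; first by rewrite mul0r mulr0 addr0.
  apply: le_trans (L_step k) _.
  have [_ bb] := beta_ge k.
  have : 2 * C * (k.+1%:R * beta k) <= 2 * C * (k.+1%:R * beta k.+1).
    by rewrite ler_wpM2l ?mulr_ge0// ler_wpM2l.
  rewrite -natr1; lra.
(* The scaled residual is the difference of consecutive multipliers, and
   [|u - w|^2 <= 2 |u|^2 + 2 |w|^2]. *)
have beta_quad k : beta k ^+ 2 * eps ^+ 2 <= 4 * L 0 + 8 * C * (k.+1%:R * beta k).
  have FL : beta k ^+ 2 * eps ^+ 2 <= dotv (beta k *: F (z k.+1)) (beta k *: F (z k.+1)).
    rewrite dotvZl dotvZr mulrA -expr2 ler_wpM2l ?sqr_ge0//.
    apply: le_trans (normr_sqr_le_dotv _).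
    by rewrite ler_pXn2r ?nnegrE//; apply: ltW.
  have := al_multiplier run (exec k) => /(congr1 (fun u => u - lam k)).
  rewrite addrAC subrr add0r => Fl; move: FL; rewrite -Fl.
  have : 0 <= dotv (lam k.+1 + lam k) (lam k.+1 + lam k) by exact: dotv_ge0.
  have Cb : 0 <= C * beta k by rewrite mulr_ge0// ltW.
  have := L_step k; have := L_sum k.
  rewrite !dotvE (dotvC (lam k) (lam k.+1)) -/(L k) -/(L k.+1) -natr1; lra.
(* Dividing [beta_quad] at [k.+1] by [beta k.+1 >= beta0], with [k + 2 <= 2 (k + 1)], gives
   [beta k.+1 * eps^2 <= D * (k + 1)]. *)
pose D := 4 * L 0 / beta0 + 16 * C.
have L00 : 0 <= L 0 by exact: dotv_ge0.
have D0 : 0 <= D by rewrite addr_ge0 ?mulr_ge0// invr_ge0 ltW.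
pose E := D / (beta0 * eps ^+ 2).
have be0 : 0 < beta0 * eps ^+ 2 by rewrite mulr_gt0// exprn_gt0.
(* A penalty update after iteration [k] forces [(k + 1)^(alpha - 1) <= E], hence [k + 1 < N]. *)
pose N := Num.bound (E `^ (alpha - 1)^-1).
have no_update k : (N <= k)%N -> `|F (z k.+1)| <= gamma * `|F (z k)|.
  move=> Nk; rewrite leNgt; apply/negP => upd.
  have bk : beta0 * (k.+1%:R `^ alpha) <= beta k.+1.
    by rewrite (al_penalty run (exec _)) ifN -?ltNge// le_max lexx orbT.
  have k1 : 1 <= k.+1%:R :> R by rewrite ler1n.
  have k0 : 0 <= k.+1%:R :> R by [].
  have [bge _] := beta_ge k.+1.
  have H1 : beta k.+1 * eps ^+ 2 <= D * k.+1%:R.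
    rewrite -(ler_pM2l (beta_gt0 k.+1)) mulrA -expr2.
    apply: le_trans (beta_quad _) _.
    have : L 0 <= L 0 / beta0 * (beta k.+1 * k.+1%:R).
      rewrite mulrAC ler_pdivlMr// ler_wpM2l//.
      by apply: le_trans bge _; rewrite ler_peMr// ltW.
    have : C * (k.+2%:R * beta k.+1) <= C * (2 * k.+1%:R * beta k.+1).
      rewrite ler_wpM2l// (ler_wpM2r (ltW (beta_gt0 _)))// -(natr1 k.+1); lra.
    rewrite /D; lra.
  have H2 : k.+1%:R `^ (alpha - 1) <= E.
    rewrite ler_pdivlMr// -(ler_pM2l (lt_le_trans ltr01 k1)).
    rewrite mulrA mulr_powRB1//; last by rewrite (lt_trans ltr01).
    rewrite [leRHS]mulrC; apply: le_trans H1.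
    by rewrite mulrA (mulrC (_ `^ _)) ler_wpM2r ?sqr_ge0.
  have ap : 0 < alpha - 1 by rewrite subr_gt0.
  have : k.+1%:R <= E `^ (alpha - 1)^-1.
    have <- : (k.+1%:R `^ (alpha - 1)) `^ (alpha - 1)^-1 = k.+1%:R.
      by rewrite -powRrM divff ?gt_eqF// powRr1.
    apply: ge0_ler_powR => //; rewrite ?nnegrE ?invr_ge0 ?powR_ge0//; first exact: ltW.
    by rewrite divr_ge0// ltW.
  have := archi_boundP (powR_ge0 E (alpha - 1)^-1); rewrite -/N.
  have : N%:R <= k.+1%:R :> R by rewrite ler_nat leqW.
  lra.
have decay j : `|F (z (N + j)%N)| <= gamma ^+ j * `|F (z N)|.
  elim: j => [|j IH]; first by rewrite addn0 expr0 mul1r.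
  rewrite addnS exprS -mulrA; apply: le_trans (no_update _ (leq_addr _ _)) _.
  by rewrite ler_pM2l.
have : (fun j => gamma ^+ j * `|F (z N)|) @ \oo --> 0 * `|F (z N)|.
  apply: cvgM; last exact: cvg_cst.
  by apply: cvg_expr; rewrite ger0_norm// ltW.
(* The index [j.+1] is taken because [Feps] bounds only residuals at successor indices. *)
rewrite mul0r => /cvgrPdist_lt/(_ _ e0)[j _ /(_ j.+1 (leqnSn j))].
rewrite sub0r normrN ger0_norm => [lt_eps|]; last first.
  by rewrite mulr_ge0// exprn_ge0// ltW.
have := Feps (N + j)%N; have := decay j.+1; rewrite addnS; lra.
Qed.

End Termination.

Theorem theorem2 (R : realType) (n p : nat)
    (f : 'rV[R]_n -> \bar R) (F : 'rV[R]_n -> 'rV[R]_p)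
    (f_proper : proper_fun f)
    (f_lsc : lower_semicontinuous f)
    (f_lb : lower_bounded f)
    (F_lip : locally_lipschitz F)
    (feasible : [set z | edom f z /\ F z = 0] !=set0)
    (z0 : 'rV[R]_n) (lam0 : 'rV[R]_p) (beta0 gamma alpha xi eps : R)
    (z0_dom : edom f z0) (z0_feas : F z0 = 0)
    (beta0_gt0 : 0 < beta0)
    (gamma_gt0 : 0 < gamma) (gamma_lt1 : gamma < 1)
    (alpha_gt1 : 1 < alpha) (xi_gt1 : 1 < xi)
    (eps_gt0 : 0 < eps)
    (z : nat -> 'rV[R]_n) (lam : nat -> 'rV[R]_p) (beta : nat -> R)
    (run : al_run f F z0 lam0 beta0 gamma alpha xi eps z lam beta) :
  exists k : nat,
    al_stops_at F eps z k /\ eps_KKT f F eps (z k.+1) (lam k.+1).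
Proof.
(* For the least [k] that passes the test all earlier tests failed, so iteration [k] is really
   executed. *)
have [k Fk k_min] := ex_minnP (al_run_reaches_feasibility f_lb z0_dom z0_feas
  beta0_gt0 gamma_gt0 gamma_lt1 alpha_gt1 xi_gt1 eps_gt0 run).
have exec : al_executed F eps z k.
  by move=> j jk; rewrite ltNge; apply/negP => /k_min; rewrite leqNgt jk.
exists k; split; split=> //.
rewrite (al_multiplier run exec).
exact: eps_stationary_multiplier_update (al_stationary run exec).
Qed.
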